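(* Under average cost pricing ($p=m+F_a/N_a$), suppose that $(AN-B)^2-4AF_a>0$ and consider the stable high-adoption equilibrium $N_{a2}^{AC*}=\frac{AN-B+K}{2A}$, where $K=\sqrt{(AN-B)^2-4AF_a}$. The equilibrium commuting cost $c_2^{AC*}$ at this equilibrium increases as the bottleneck capacity $\mu$ increases (i.e. $\frac{d c_2^{AC*}}{d\mu}>0$, all other parameters being fixed) when $$K<\left(AN-B-\frac{2F_a}{N}\right)\frac{1-\kappa}{1+\kappa}.$$
   Context: A continuum of commuters of mass $N>0$ splits between normal vehicles (NV, mass $N_n\ge 0$) and shared autonomous vehicles (SAV, mass $N_a\ge0$), $N_n+N_a=N$, all passing a bottleneck of capacity $\mu>0$. Parameters: free-flow time $t_f\ge 0$; NV fixed cost $F_n\ge 0$; SAV waiting cost $w\ge 0$; SAV marginal operating cost $m\ge 0$; SAV fixed operating cost $F_a>0$; schedule-delay penalties $\beta,\gamma>0$; value-of-time parameter $\theta$ with $\beta<\theta<1$; capacity parameter $\kappa$ with $0<\kappa<1$. Given the split and the SAV fare $p$, the mode-specific commuting costs (in departure-time equilibrium) are $$c_n^*(N_n,N_a)=\frac{\beta\gamma}{\mu(\beta+\gamma)}(N_n+\kappa N_a)+t_f+F_n,\qquad c_a^*(N_n,N_a)=\frac{\beta\gamma}{\mu(\beta+\gamma)}(\theta N_n+\kappa N_a)+\theta t_f+p+w .$$ In an equilibrium where both modes are used, $c_n^*=c_a^*$, and the common value is the equilibrium commuting cost; thus $c_2^{AC*}=c_n^*(N-N_{a2}^{AC*},N_{a2}^{AC*})$.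 Set $A=\frac{\beta\gamma(1-\theta)}{(\beta+\gamma)\mu}$ (a function of $\mu$), $B=\theta t_f+m+w-(t_f+F_n)$. Standing assumption: $0<B<AN$. *)

(* Defs.v *)
From Stdlib Require Import Reals Lra.
From Coquelicot Require Import Coquelicot.
Open Scope R_scope.

(* The bottleneck capacity [mu] is kept as the last argument of the equilibrium
   quantities because they are differentiated in it. *)

Definition c_n (beta gamma kappa t_f F_n mu N_n N_a : R) : R :=
  beta * gamma / (mu * (beta + gamma)) * (N_n + kappa * N_a) + t_f + F_n.

Definition c_a (beta gamma theta kappa t_f w p mu N_n N_a : R) : R :=
  beta * gamma / (mu * (beta + gamma)) * (theta * N_n + kappa * N_a)
  + theta * t_f + p + w.

Definition average_cost_fare (m F_a N_a : R) : R := m + F_a / N_a.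

Definition A_coef (beta gamma theta mu : R) : R :=
  beta * gamma * (1 - theta) / ((beta + gamma) * mu).

Definition B_coef (theta t_f F_n w m : R) : R :=
  theta * t_f + m + w - (t_f + F_n).

Definition disc (N t_f F_n w m F_a beta gamma theta mu : R) : R :=
  (A_coef beta gamma theta mu * N - B_coef theta t_f F_n w m) ^ 2
  - 4 * A_coef beta gamma theta mu * F_a.

Definition K_coef (N t_f F_n w m F_a beta gamma theta mu : R) : R :=
  sqrt (disc N t_f F_n w m F_a beta gamma theta mu).

Definition N_a1_AC (N t_f F_n w m F_a beta gamma theta mu : R) : R :=
  (A_coef beta gamma theta mu * N - B_coef theta t_f F_n w m
   - K_coef N t_f F_n w m F_a beta gamma theta mu)
  / (2 * A_coef beta gamma theta mu).

Definition N_a2_AC (N t_f F_n w m F_a beta gamma theta mu : R) : R :=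
  (A_coef beta gamma theta mu * N - B_coef theta t_f F_n w m
   + K_coef N t_f F_n w m F_a beta gamma theta mu)
  / (2 * A_coef beta gamma theta mu).

Definition c_2_AC (N t_f F_n w m F_a beta gamma theta kappa mu : R) : R :=
  let N_a2 := N_a2_AC N t_f F_n w m F_a beta gamma theta mu in
  c_n beta gamma kappa t_f F_n mu (N - N_a2) N_a2.

(* Under average cost pricing the cost gap between the two modes factors over
   [N_a1_AC < N_a2_AC].  So these are exactly the splits with N_a > 0 and
   c_n = c_a, and the gap changes sign from negative to positive at [N_a2_AC]:
   the high-adoption root is the stable one. *)
Lemma cost_gap_AC (N t_f F_n w m F_a beta gamma theta kappa mu N_a : R) :
  0 < mu -> 0 < beta -> 0 < gamma -> theta < 1 ->
  0 < disc N t_f F_n w m F_a beta gamma theta mu ->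
  N_a <> 0 ->
  N_a * (c_a beta gamma theta kappa t_f w (average_cost_fare m F_a N_a) mu
           (N - N_a) N_a
         - c_n beta gamma kappa t_f F_n mu (N - N_a) N_a)
  = A_coef beta gamma theta mu
    * (N_a - N_a1_AC N t_f F_n w m F_a beta gamma theta mu)
    * (N_a - N_a2_AC N t_f F_n w m F_a beta gamma theta mu).
Proof.
intros Hmu Hb Hg Ht HD Hna.
set (A := A_coef beta gamma theta mu).
assert (HA : 0 < A).
{ unfold A, A_coef; apply Rdiv_lt_0_compat.
  - apply Rmult_lt_0_compat; [apply Rmult_lt_0_compat|]; lra.
  - apply Rmult_lt_0_compat; lra. }
assert (HK : K_coef N t_f F_n w m F_a beta gamma theta mu ^ 2
             = (A * N - B_coef theta t_f F_n w m) ^ 2 - 4 * A * F_a).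
{ unfold K_coef; rewrite pow2_sqrt by lra; reflexivity. }
transitivity (A * N_a ^ 2 - (A * N - B_coef theta t_f F_n w m) * N_a + F_a).
- unfold A, A_coef, B_coef, c_a, c_n, average_cost_fare; field; lra.
- unfold N_a1_AC, N_a2_AC; fold A.
  set (K := K_coef N t_f F_n w m F_a beta gamma theta mu) in *.
  set (B := B_coef theta t_f F_n w m) in *.
  replace F_a with (((A * N - B) ^ 2 - K ^ 2) / (4 * A))
    by (rewrite HK; field; lra).
  field; lra.
Qed.

Lemma N_a2_AC_interior (N t_f F_n w m F_a beta gamma theta mu : R) :
  0 < mu -> 0 < beta -> 0 < gamma -> theta < 1 -> 0 < F_a ->
  0 < B_coef theta t_f F_n w m < A_coef beta gamma theta mu * N ->
  0 < disc N t_f F_n w m F_a beta gamma theta mu ->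
  0 < N_a1_AC N t_f F_n w m F_a beta gamma theta mu
    < N_a2_AC N t_f F_n w m F_a beta gamma theta mu
  /\ N_a2_AC N t_f F_n w m F_a beta gamma theta mu < N.
Proof.
intros Hmu Hb Hg Ht HF [HB HAN] HD.
set (A := A_coef beta gamma theta mu) in *.
assert (HA : 0 < A).
{ unfold A, A_coef; apply Rdiv_lt_0_compat.
  - apply Rmult_lt_0_compat; [apply Rmult_lt_0_compat|]; lra.
  - apply Rmult_lt_0_compat; lra. }
assert (HK2 : K_coef N t_f F_n w m F_a beta gamma theta mu ^ 2
             = (A * N - B_coef theta t_f F_n w m) ^ 2 - 4 * A * F_a).
{ unfold K_coef; rewrite pow2_sqrt by lra; reflexivity. }
assert (HK : 0 < K_coef N t_f F_n w m F_a beta gamma theta mu)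
  by (apply sqrt_lt_R0; exact HD).
unfold N_a1_AC, N_a2_AC; fold A.
set (K := K_coef N t_f F_n w m F_a beta gamma theta mu) in *.
set (B := B_coef theta t_f F_n w m) in *.
assert (HAF : 0 < A * F_a) by (apply Rmult_lt_0_compat; assumption).
assert (HKlt : K < A * N - B).
{ apply Rnot_le_lt; intro H.
  assert ((A * N - B) ^ 2 <= K ^ 2) by (apply pow_incr; lra); lra. }
repeat split.
- apply Rdiv_lt_0_compat; lra.
- apply Rmult_lt_compat_r; [apply Rinv_0_lt_compat|]; lra.
- apply Rmult_lt_reg_r with (2 * A); [lra|].
  unfold Rdiv; rewrite Rmult_assoc, Rinv_l, Rmult_1_r by lra; lra.
Qed.

(* Main.v *)
Require Import Defs.
From Stdlib Require Import Reals Lra.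
From Coquelicot Require Import Coquelicot.
Open Scope R_scope.

(** Capacity enters the equilibrium cost only through [A = A_coef], since
    [beta * gamma / (mu * (beta + gamma)) = A / (1 - theta)].  Substituting the
    high-adoption split [(A N - B + K) / (2 A)] into [c_n] cancels the
    denominator [2 A] and leaves

      c = ((1 + kappa) A N + (1 - kappa) (B - K)) / (2 (1 - theta)) + t_f + F_n

    with [K = sqrt ((A N - B)^2 - 4 A F_a)].  As [A] varies,
    [dK/dA = (N (A N - B) - 2 F_a) / K], so [dc/dA] has the sign of
    [(1 + kappa) N K - (1 - kappa) (N (A N - B) - 2 F_a)], and the assumed bound
    on [K] says exactly that this is negative.  Since [A] is inversely
    proportional to [mu], [dA/dmu = - A / mu < 0], and the cost increases with
    capacity.  The lemmas are the reduced form of the cost, its derivative in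
    [A], the derivative of [A] in [mu], and their composition. *)

(** The equilibrium cost at the high-adoption split, as a function of the
    congestion coefficient [a = A_coef] with [b = B_coef]. *)
Definition reduced_cost (N t_f F_n F_a theta kappa b a : R) : R :=
  ((1 + kappa) * a * N
   + (1 - kappa) * (b - sqrt ((a * N - b) ^ 2 - 4 * a * F_a)))
  / (2 * (1 - theta)) + t_f + F_n.

Lemma A_coef_pos (beta gamma theta mu : R) :
  0 < beta -> 0 < gamma -> theta < 1 -> 0 < mu ->
  0 < A_coef beta gamma theta mu.
Proof.
intros Hb Hg Ht Hmu; unfold A_coef; apply Rdiv_lt_0_compat.
- apply Rmult_lt_0_compat; [apply Rmult_lt_0_compat|]; lra.
- apply Rmult_lt_0_compat; lra.
Qed.

Lemma c_2_AC_reduced (N t_f F_n w m F_a beta gamma theta kappa mu : R) :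
  0 < beta -> 0 < gamma -> theta < 1 -> 0 < mu ->
  c_2_AC N t_f F_n w m F_a beta gamma theta kappa mu
  = reduced_cost N t_f F_n F_a theta kappa (B_coef theta t_f F_n w m)
      (A_coef beta gamma theta mu).
Proof.
intros Hb Hg Ht Hmu.
pose proof (A_coef_pos beta gamma theta mu Hb Hg Ht Hmu) as HA.
unfold c_2_AC, N_a2_AC, K_coef, Defs.disc, reduced_cost, c_n; cbv zeta.
replace (beta * gamma / (mu * (beta + gamma)))
  with (A_coef beta gamma theta mu / (1 - theta))
  by (unfold A_coef; field; lra).
field; lra.
Qed.

Lemma is_derive_reduced_cost (N t_f F_n F_a theta kappa b a : R) :
  theta < 1 -> 0 < (a * N - b) ^ 2 - 4 * a * F_a ->
  is_derive (reduced_cost N t_f F_n F_a theta kappa b) a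
    (((1 + kappa) * N
      - (1 - kappa) * ((N * (a * N - b) - 2 * F_a)
                       / sqrt ((a * N - b) ^ 2 - 4 * a * F_a)))
     / (2 * (1 - theta))).
Proof.
intros Ht HD.
pose proof (sqrt_lt_R0 _ HD) as HK.
unfold reduced_cost; auto_derive.
- simpl in HD |- *; lra.
- replace ((a * N + - b) * ((a * N + - b) * 1) + - (4 * a * F_a))
    with ((a * N - b) ^ 2 - 4 * a * F_a) by ring.
  simpl pred.
  field; lra.
Qed.

Lemma is_derive_A_coef (beta gamma theta mu : R) :
  0 < beta + gamma -> 0 < mu ->
  is_derive (A_coef beta gamma theta) mu (- (A_coef beta gamma theta mu / mu)).
Proof.
intros Hbg Hmu; unfold A_coef; auto_derive.
- assert (0 < (beta + gamma) * mu) by (apply Rmult_lt_0_compat; lra); lra.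
- field; lra.
Qed.

(** The discriminant is written with its qualified name because [disc] alone
    denotes the open disc of the standard library. *)
Lemma is_derive_c_2_AC (N t_f F_n w m F_a beta gamma theta kappa mu : R) :
  0 < beta -> 0 < gamma -> theta < 1 -> 0 < mu ->
  0 < Defs.disc N t_f F_n w m F_a beta gamma theta mu ->
  let A := A_coef beta gamma theta mu in
  let B := B_coef theta t_f F_n w m in
  let K := K_coef N t_f F_n w m F_a beta gamma theta mu in
  is_derive (fun x : R => c_2_AC N t_f F_n w m F_a beta gamma theta kappa x) mu
    (A / (2 * mu * (1 - theta) * K)
     * ((1 - kappa) * (N * (A * N - B) - 2 * F_a) - (1 + kappa) * N * K)).
Proof.
intros Hb Hg Ht Hmu HD A B K.
assert (HK : 0 < K) by (apply sqrt_lt_R0; exact HD).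
(* The reduced form is needed only near [mu], where capacities are positive. *)
apply is_derive_ext_loc with
  (f := fun x => reduced_cost N t_f F_n F_a theta kappa B
                   (A_coef beta gamma theta x)).
{ apply (filter_imp (fun x => 0 < x)).
  - intros x Hx; symmetry; apply c_2_AC_reduced; assumption.
  - exact (open_gt 0 mu Hmu). }
replace (A / (2 * mu * (1 - theta) * K)
         * ((1 - kappa) * (N * (A * N - B) - 2 * F_a) - (1 + kappa) * N * K))
  with (scal (- (A / mu))
          (((1 + kappa) * N - (1 - kappa) * ((N * (A * N - B) - 2 * F_a) / K))
           / (2 * (1 - theta)))).
- apply (is_derive_comp (reduced_cost N t_f F_n F_a theta kappa B)).
  + exact (is_derive_reduced_cost N t_f F_n F_a theta kappa B A Ht HD).
  + apply is_derive_A_coef; lra.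
- unfold scal; simpl; unfold mult; simpl; field; lra.
Qed.

Theorem theorem2
  (N t_f F_n w m F_a beta gamma theta kappa mu : R)
  (HN : 0 < N) (Hmu : 0 < mu)
  (Ht_f : 0 <= t_f) (HF_n : 0 <= F_n) (Hw : 0 <= w) (Hm : 0 <= m)
  (HF_a : 0 < F_a) (Hbeta : 0 < beta) (Hgamma : 0 < gamma)
  (Htheta : beta < theta < 1) (Hkappa : 0 < kappa < 1)
  (HB : 0 < B_coef theta t_f F_n w m < A_coef beta gamma theta mu * N)
  (Hdisc : (A_coef beta gamma theta mu * N - B_coef theta t_f F_n w m) ^ 2
           - 4 * A_coef beta gamma theta mu * F_a > 0)
  (HK : K_coef N t_f F_n w m F_a beta gamma theta mu
        < (A_coef beta gamma theta mu * N - B_coef theta t_f F_n w m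
           - 2 * F_a / N) * ((1 - kappa) / (1 + kappa))) :
  ex_derive (fun x : R => c_2_AC N t_f F_n w m F_a beta gamma theta kappa x) mu
  /\ 0 < Derive (fun x : R => c_2_AC N t_f F_n w m F_a beta gamma theta kappa x) mu.
Proof.
assert (Ht : theta < 1) by lra.
pose proof (is_derive_c_2_AC N t_f F_n w m F_a beta gamma theta kappa mu
              Hbeta Hgamma Ht Hmu Hdisc) as Hder.
cbv zeta in Hder.
split; [eexists; exact Hder|].
rewrite (is_derive_unique _ _ _ Hder).
pose proof (A_coef_pos beta gamma theta mu Hbeta Hgamma Ht Hmu) as HA.
assert (HKpos : 0 < K_coef N t_f F_n w m F_a beta gamma theta mu)
  by (apply sqrt_lt_R0; exact Hdisc).
set (A := A_coef beta gamma theta mu) in *.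
set (B := B_coef theta t_f F_n w m) in *.
set (K := K_coef N t_f F_n w m F_a beta gamma theta mu) in *.
apply Rmult_lt_0_compat.
- apply Rdiv_lt_0_compat; [exact HA|].
  repeat apply Rmult_lt_0_compat; lra.
- (* The bound on [K], multiplied by [(1 + kappa) N > 0]. *)
  assert (HcN : 0 < (1 + kappa) * N) by (apply Rmult_lt_0_compat; lra).
  apply (Rmult_lt_compat_l _ _ _ HcN) in HK.
  replace ((1 + kappa) * N
           * ((A * N - B - 2 * F_a / N) * ((1 - kappa) / (1 + kappa))))
    with ((1 - kappa) * (N * (A * N - B) - 2 * F_a)) in HK by (field; lra).
  lra.
Qed.
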